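(* Suppose that (C1) $\mathbb P\left(\lambda_0+\sum_{l=1}^L\mu_0^l>0\right)=1$; and (C2) $\mathbb P\Big(\sum_{n=1}^\infty\frac{1}{\lambda_n+\sum_{l=1}^L\mu_n^l}=\infty,\ \sum_{n=-\infty}^0\frac{1}{\max_{1\le k\le L}\{\lambda_{nL-k}+\sum_{l=1}^L\mu_{nL-k}^l\}}=\infty\Big)=1.$ Then, for $\mathbb P$-almost every $\omega$, there is exactly one transition matrix $(\overline p_{ij}(t))_{i,j\in\mathbb Z,\,t\ge 0}$ such that $$\lim_{t\to 0}\frac{\overline p_{ij}(t)-\delta_{ij}}{t}=q_{ij},\qquad i,j\in\mathbb Z .$$
   Context: Fix an integer $L\ge 1$. Let $\Omega$ be the set of all $\omega=(\omega_i)_{i\in\mathbb Z}=(\mu_i^L,\dots,\mu_i^1,\lambda_i)_{i\in\mathbb Z}$ with $\lambda_i,\mu_i^l\ge 0$ for all $i\in\mathbb Z$, $l=1,\dots,L$, equipped with its Borel $\sigma$-algebra $\mathcal F$. Let $\mathbb P$ be a probability measure on $(\Omega,\mathcal F)$ under which $(\omega_i)_{i\in\mathbb Z}$ is a sequence of i.i.d. random vectors. Given $\omega$, define the conservative $Q$-matrix $Q=(q_{ij})_{i,j\in\mathbb Z}$ by $q_{i,i+1}=\lambda_i$; $q_{i,i-l}=\mu_i^l$ for $l=1,\dots,L$; $q_{ii}=-(\lambda_i+\sum_{l=1}^L\mu_i^l)$; and $q_{ij}=0$ otherwise. A transition matrix means a standard transition function of a continuous time Markov chain on $\mathbb Z$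 (nonnegative entries, semigroup property, $\overline p_{ij}(t)\to\delta_{ij}$ as $t\to0$). $\delta_{ij}$ is the Kronecker delta. *)

(* Defs.v *)
From HB Require Import structures.
From mathcomp Require Import all_boot all_order all_algebra.
From mathcomp Require Import all_classical all_reals all_analysis.

Set Implicit Arguments.
Unset Strict Implicit.
Unset Printing Implicit Defensive.

Import Order.TTheory GRing.Theory Num.Theory.
Import numFieldNormedType.Exports.

Local Open Scope classical_set_scope.
Local Open Scope ring_scope.

Notation borel T := (g_sigma_algebraType (@open T)).

Section Independence.
Local Open Scope ereal_scope.
Context d (R : realType) (Omega : measurableType d) (P : probability Omega R).
Context d' (E : measurableType d') (I : choiceType) (X : I -> Omega -> E).

Definition mutually_independent : Prop :=
  forall (s : seq I) (B : I -> set E), uniq s ->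
    (forall i, measurable (B i)) ->
    P (\bigcap_(i in [set` s]) X i @^-1` B i) =
      \prod_(i <- s) P (X i @^-1` B i).

Definition identically_distributed : Prop :=
  forall (i j : I) (B : set E), measurable B ->
    P (X i @^-1` B) = P (X j @^-1` B).

Definition iid : Prop := mutually_independent /\ identically_distributed.

End Independence.

Section Environment.
Context (R : realType) (L : nat).

(* Topologized as a subspace of the product, over int, of R^(L+1). *)
Definition env : Type :=
  set_type [set w : {ptws int -> 'rV[R]_L.+1} | forall i k, 0 <= w i 0 k].

HB.instance Definition _ := Topological.on env.

Lemma env0_subproof (i : int) (k : 'I_L.+1) :
  0 <= (0 : 'rV[R]_L.+1) 0 k.
Proof. by rewrite mxE. Qed.

HB.instance Definition _ := isPointed.Build env
  (exist _ (fun=> 0 : 'rV[R]_L.+1) (mem_set env0_subproof)).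

Definition site (i : int) (w : env) : borel 'rV[R]_L.+1 := set_val w i.

(* The entries of site i w are, in order, mu_i^L, ..., mu_i^1, lambda_i. *)
Definition lambda (w : env) (i : int) : R := (site i w : 'rV_L.+1) 0 ord_max.

(* mu w i l is mu_i^(l+1), as l : 'I_L is counted from 0. *)
Definition mu (w : env) (i : int) (l : 'I_L) : R :=
  (site i w : 'rV_L.+1) 0 (lift ord_max (rev_ord l)).

Definition rate (w : env) (i : int) : R :=
  lambda w i + \sum_(l < L) mu w i l.

(* At most one l contributes to the last sum. *)
Definition qmatrix (w : env) (i j : int) : R :=
  if j == i + 1 then lambda w i
  else if j == i then - rate w i
  else \sum_(l < L | j == i - (l.+1)%:Z) mu w i l.

(* The maximum of rate w (n * L - k) over 1 <= k <= L; the rates are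
   nonnegative, so for L > 0 the default value 0 plays no role. *)
Definition block_rate (w : env) (n : int) : R :=
  \big[Num.max/0]_(k < L) rate w (n * L%:Z - (k.+1)%:Z).

End Environment.

Section TransitionMatrix.
Context (R : realType).

(* The values of p at negative times are irrelevant. *)
Record transition_matrix (p : R -> int -> int -> R) : Prop :=
  TransitionMatrix {
    tm_ge0 : forall (t : R) i j, 0 <= t -> 0 <= p t i j;
    tm_sum1 : forall (t : R) i, 0 <= t ->
      (\esum_(j in [set: int]) (p t i j)%:E = 1)%E;
    tm_semigroup : forall (s t : R) i j, 0 <= s -> 0 <= t ->
      ((p (s + t) i j)%:E =
        \esum_(k in [set: int]) (p s i k * p t k j)%:E)%E;
    tm_standard : forall i j, p t i j @[t --> 0^'+] --> ((i == j)%:R : R)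
  }.

Definition has_qmatrix (p : R -> int -> int -> R) (q : int -> int -> R) :
    Prop :=
  forall i j, (p t i j - (i == j)%:R) / t @[t --> 0^'+] --> q i j.

End TransitionMatrix.

(* Main.v *)
(* Almost surely every rate is positive, so it suffices to treat a fixed
   environment. There the partial sums of 1 / rate to the right and of
   1 / block_rate to the left form a function V that tends to infinity at both
   ends, and Q V <= 1 because a jump to the right moves by one site and a jump
   to the left enters at most the next block. Comparison with V along a grid of
   small step (a discrete maximum principle) shows that a bounded solution of
   Kolmogorov's backward equation u' = Q u is determined by its initial value.
   Existence: Euler's method for the backward equation, with the rows too
   fast for the step frozen, stays between 0 and 1 and satisfies
   a second order estimate uniform in the step; this estimate passes to an
   ultrafilter limit of the approximations, and then to infinite sums.
   Uniqueness turns the resulting solutions into a transition matrix (total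
   mass one and the semigroup property are equalities of two solutions), and
   every transition matrix with this Q-matrix solves the backward equation. *)
Require Import Defs.
From HB Require Import structures.
From mathcomp Require Import all_boot all_order all_algebra.
From mathcomp Require Import all_classical all_reals all_analysis.
From mathcomp Require Import measurable_realfun zify ring lra.
Import Order.TTheory GRing.Theory Num.Theory.
Import numFieldNormedType.Exports.
Local Open Scope classical_set_scope.
Local Open Scope ring_scope.

Set Implicit Arguments.
Unset Strict Implicit.
Unset Printing Implicit Defensive.

(** * Sums over a countable type as limits along an enumeration *)

Section FirstElements.
Context (R : realType) (T : countType).

(** [pickle_inv], unlike [unpickle], decodes an element from one code only, so the list has no
    repetitions. *)
Definition first_elements (n : nat) : seq T := pmap (@pickle_inv T) (iota 0 n).

Lemma first_elements_uniq n : uniq (first_elements n).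
Proof. by apply: (pmap_uniq (@pickle_invK T)); exact: iota_uniq. Qed.

Lemma first_elementsD m n : exists s, first_elements (m + n) = first_elements m ++ s.
Proof.
by exists (pmap (@pickle_inv T) (iota m n)); rewrite /first_elements iotaD pmap_cat.
Qed.

Lemma sub_first_elements m n : (m <= n)%N ->
  {subset first_elements m <= first_elements n}.
Proof.
move=> /subnKC <- x; have [s ->] := first_elementsD m (n - m).
by rewrite mem_cat => ->.
Qed.

Lemma mem_first_elements x : x \in first_elements (pickle x).+1.
Proof.
rewrite mem_pmap; apply/mapP; exists (pickle x); last by rewrite pickleK_inv.
by rewrite mem_iota add0n ltnSn.
Qed.

Lemma ler_sum_first_elements (a : T -> R) m n : (forall x, 0 <= a x) ->
  (m <= n)%N -> \sum_(x <- first_elements m) a x <= \sum_(x <- first_elements n) a x.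
Proof.
move=> a0 /subnKC <-; have [s ->] := first_elementsD m (n - m).
by rewrite big_cat lerDl sumr_ge0.
Qed.

Lemma ler_sum_subset (a : T -> R) (s z : seq T) : (forall x, 0 <= a x) ->
  uniq s -> uniq z -> {subset s <= z} -> \sum_(x <- s) a x <= \sum_(x <- z) a x.
Proof.
move=> a0 us uz sz.
have fs : perm_eq [seq x <- z | x \in s] s.
  apply: uniq_perm => //; first exact: filter_uniq.
  by move=> x; rewrite mem_filter; apply: andb_idr; exact: sz.
by rewrite -(perm_big _ fs) big_filter [leRHS](bigID (mem s))/= lerDl sumr_ge0.
Qed.

Lemma le_sum_esum (a : T -> R) (s : seq T) : (forall x, 0 <= a x) -> uniq s ->
  ((\sum_(x <- s) a x)%:E <= \esum_(x in [set: T]) (a x)%:E)%E.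
Proof.
move=> a0 us; apply: esum_ge; exists [set` s]; first by split => [|x _//]; exact: finite_seq.
by rewrite -fsbig_seq// sumEFin.
Qed.

(** Every finite subset lies in an initial segment of the enumeration, so the supremum over finite
    subsets is the limit of the partial sums. *)
Lemma esum_first_elements (a : T -> R) (S : R) : (forall x, 0 <= a x) ->
  \sum_(x <- first_elements n) a x @[n --> \oo] --> S ->
  (\esum_(x in [set: T]) (a x)%:E = S%:E)%E.
Proof.
move=> a0 aS; apply/eqP; rewrite eq_le; apply/andP; split.
  apply: ge_ereal_sup => _ [A [/finite_seqP[s ->] _] <-].
  rewrite (_ : [set` s] = [set` undup s]); last first.
    by apply/seteqP; split => x /=; rewrite mem_undup.
  rewrite -fsbig_seq ?undup_uniq// sumEFin lee_fin.
  have [n sn] : exists n, {subset undup s <= first_elements n}.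
    elim: (undup s) => [|x r [n IH]]; first by exists 0%N.
    exists (maxn n (pickle x).+1) => y; rewrite inE => /predU1P[->|/IH].
      by apply: (sub_first_elements (leq_maxr _ _)); exact: mem_first_elements.
    exact: (sub_first_elements (leq_maxl _ _)).
  apply: (cvgr_to_ge aS); exists n => // m /= nm.
  apply: ler_sum_subset; rewrite ?undup_uniq ?first_elements_uniq//.
  by move=> x /sn; exact: sub_first_elements.
have le n := le_sum_esum a0 (first_elements_uniq n).
case E : esum le => [r||] le.
- by rewrite lee_fin; apply: (cvgr_to_le aS); apply: nearW => n; rewrite -lee_fin.
- by rewrite leey.
- by have := le 0%N.
Qed.

End FirstElements.
Arguments first_elements : clear implicits.

(** * Row-finite Q-matrices and the backward equation *)

Section Generator.
Context {R : realType} {T : countType}.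
Context (q : T -> T -> R) (N : T -> seq T).

(** [N i] is to list [i] and every site charged by row [i], so that [q] acts on arbitrary functions
    by finite sums. *)
Definition gen (f : T -> R) (i : T) : R := \sum_(k <- N i) q i k * f k.

Definition row_norm (i : T) : R := \sum_(k <- N i) `|q i k|.

(* Kolmogorov's backward equation u' = gen u, with a right derivative uniform
   in t; this form passes to pointwise limits. *)
Definition backward (u : R -> T -> R) : Prop := forall i (e : R), 0 < e ->
  exists2 d : R, 0 < d & forall t h, 0 <= t -> 0 <= h <= d ->
    `|u (t + h) i - u t i - h * gen (u t) i| <= e * h.

Definition unit_valued (f : T -> R) : Prop := forall i, 0 <= f i <= 1.

Lemma genB f g i : gen (fun k => f k - g k) i = gen f i - gen g i.
Proof. by rewrite /gen -sumrB; apply: eq_bigr => k _; rewrite mulrBr. Qed.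

Lemma genD f g i : gen (fun k => f k + g k) i = gen f i + gen g i.
Proof. by rewrite /gen -big_split; apply: eq_bigr => k _; rewrite mulrDr. Qed.

Lemma genZ c f i : gen (fun k => c * f k) i = c * gen f i.
Proof. by rewrite /gen mulr_sumr; apply: eq_bigr => k _; rewrite mulrCA. Qed.

Lemma gen_sum (J : Type) (s : seq J) (f : J -> T -> R) i :
  gen (fun k => \sum_(j <- s) f j k) i = \sum_(j <- s) gen (f j) i.
Proof.
rewrite /gen exchange_big /=; apply: eq_bigr => k _.
by rewrite mulr_sumr.
Qed.

Lemma ler_norm_gen f i (c : R) : (forall k, `|f k| <= c) ->
  `|gen f i| <= row_norm i * c.
Proof.
move=> fc; rewrite /gen /row_norm mulr_suml.
rewrite (le_trans (ler_norm_sum _ _ _))// ler_sum// => k _.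
by rewrite normrM ler_wpM2l.
Qed.

Lemma backwardB u v : backward u -> backward v ->
  backward (fun t i => u t i - v t i).
Proof.
move=> ub vb i e e0; have e20 : 0 < e / 2 by rewrite divr_gt0.
have [d d0 ubd] := ub i _ e20; have [d' d'0 vbd] := vb i _ e20.
exists (Num.min d d'); first by rewrite lt_min d0.
move=> t h t0 /andP[h0]; rewrite le_min => /andP[hd hd'].
have := ubd t h t0; rewrite h0 hd => /(_ isT) uh.
have := vbd t h t0; rewrite h0 hd' => /(_ isT) vh.
rewrite genB (_ : _ - _ - _ = (u (t + h) i - u t i - h * gen (u t) i) -
  (v (t + h) i - v t i - h * gen (v t) i)); last by ring.
rewrite (le_trans (ler_normB _ _))//.
by rewrite [leRHS](_ : _ = e / 2 * h + e / 2 * h) ?lerD//; field.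
Qed.

(** For [h] up to [e / (|C i| + 1)] a second order error is at most [e * h]; the added 1 keeps the
    denominator positive. *)
Lemma backward_quadratic (C : T -> R) u :
  (forall t h i, 0 <= t -> 0 <= h ->
    `|u (t + h) i - u t i - h * gen (u t) i| <= C i * h ^+ 2) ->
  backward u.
Proof.
move=> uC i e e0.
have C0 : 0 < `|C i| + 1 by rewrite ltr_wpDl.
exists (e / (`|C i| + 1)); first by rewrite divr_gt0.
move=> t h t0 /andP[h0]; rewrite ler_pdivlMr// => hC.
rewrite (le_trans (uC _ _ _ t0 h0))// expr2 mulrA ler_wpM2r//.
rewrite (le_trans _ hC)// mulrC ler_wpM2l//.
by rewrite (le_trans (ler_norm _))// lerDl.
Qed.

(** * Maximum principle and uniqueness of bounded solutions *)

Context (q_ge0 : forall i k, k != i -> 0 <= q i k)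
  (q_out : forall i k, k \notin N i -> q i k = 0)
  (N_uniq : forall i, uniq (N i)) (N_self : forall i, i \in N i)
  (q_sum0 : forall i, \sum_(k <- N i) q i k = 0).

Lemma gen_const c i : gen (fun=> c) i = 0.
Proof. by rewrite /gen -mulr_suml q_sum0 mul0r. Qed.

Lemma big_neighbours i (F : T -> R) :
  \sum_(k <- N i) (i == k)%:R * F k = F i.
Proof.
rewrite (bigD1_seq i)//= eqxx mul1r big1 ?addr0// => k ki.
by rewrite eq_sym (negPf ki) mul0r.
Qed.

Lemma gen_delta i j : gen (fun k => (k == j)%:R) i = q i j.
Proof.
have [jN|jN] := boolP (j \in N i).
  rewrite /gen (bigD1_seq j)//= eqxx mulr1 big1 ?addr0// => k kj.
  by rewrite (negPf kj) mulr0.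
rewrite q_out// /gen big_seq big1// => k kN.
by case: eqP kN jN => [-> ->//|_ _ _]; rewrite mulr0.
Qed.

(* For 0 <= h <= 1 / |q i i|, a step of Euler's method is an average over the
   neighbours of i. *)
Lemma ler_euler f g h i : 0 <= h -> 0 <= 1 + h * q i i ->
  (forall k, f k <= g k) -> f i + h * gen f i <= g i + h * gen g i.
Proof.
move=> h0 hq fg.
have E F : F i + h * gen F i = \sum_(k <- N i) ((i == k)%:R + h * q i k) * F k.
  rewrite -(big_neighbours i F) /gen mulr_sumr -big_split/=.
  by apply: eq_bigr => k _; rewrite mulrDl mulrA.
rewrite !E ler_sum// => k _; rewrite ler_wpM2l//.
have [<-//|ik] := eqVneq i k.
by rewrite add0r mulr_ge0// q_ge0// eq_sym.
Qed.

Lemma euler_small i : exists2 d : R, 0 < d &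
  forall h, 0 <= h <= d -> 0 <= 1 + h * q i i.
Proof.
have C0 : 0 < `|q i i| + 1 by rewrite ltr_wpDl.
exists (`|q i i| + 1)^-1; first by rewrite invr_gt0.
move=> h /andP[h0 hd]; rewrite -lerBlDl sub0r.
rewrite (le_trans _ (lerNnormlW (lexx _)))// lerN2 normrM (ger0_norm h0).
rewrite (@le_trans _ _ (h * (`|q i i| + 1)))//; first by rewrite ler_wpM2l// lerDl.
by rewrite -ler_pdivlMr// mul1r.
Qed.

(* The comparison is made along a grid of small step, on which V controls u
   outside of a finite set. *)
Lemma backward_le0 (V : T -> R) (u : R -> T -> R) (M : R) :
  (forall i, 0 <= V i) -> (forall i, gen V i <= 1) ->
  (forall r, exists s : seq T, forall i, i \notin s -> r <= V i) ->
  backward u -> (forall t i, 0 <= t -> u t i <= M) ->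
  (forall i, u 0 i <= 0) -> forall t i, 0 <= t -> u t i <= 0.
Proof.
move=> V0 VG Vs ub uM u0 t i t0.
(* The barrier grows at rate [2 * e]: one [e] bounds [gen (e * V)], the other absorbs the
   discretisation error. Afterwards [e] tends to 0. *)
suff eu e : 0 < e -> u t i <= e * (V i + 2 * t).
  apply/ler_addgt0Pl => e e0; rewrite addr0.
  have c0 : 0 < V i + 2 * t + 1 by rewrite ltr_wpDl// addr_ge0// mulr_ge0.
  rewrite (le_trans (eu _ (divr_gt0 e0 c0)))//.
  by rewrite -mulrA ger_pMr// mulrC ler_pdivrMr// mul1r lerDl.
(* Outside [s], [e * V] is at least the bound [M] on [u]. *)
move=> e0; have [s sV] := Vs (M / e).
(* As [s] is finite, one [d] makes Euler's step monotone and accurate at all its sites. *)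
have [d d0 ds] : exists2 d : R, 0 < d & forall h, 0 <= h <= d -> forall k, k \in s ->
    0 <= 1 + h * q k k /\ forall r, 0 <= r ->
    u (r + h) k <= u r k + h * gen (u r) k + e * h.
  elim: s {sV} => [|k s [d d0 IH]]; first by exists 1.
  have [d1 d10 d1q] := euler_small k; have [d2 d20 d2u] := ub k e e0.
  exists (Num.min d (Num.min d1 d2)); first by rewrite !lt_min d0 d10.
  move=> h /andP[h0]; rewrite !le_min => /and3P[hd hd1 hd2] l.
  rewrite inE => /predU1P[->|ls]; last by apply: IH => //; rewrite h0.
  split=> [|r r0]; first by rewrite d1q// h0.
  have := d2u r h r0; rewrite h0 hd2 => /(_ isT).
  by move=> /(le_trans (ler_norm _)); rewrite -addrA -opprD lerBlDl.
have [m md] : exists m : nat, t / m.+1%:R <= d.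
  exists (Num.truncn (t / d)).
  rewrite ler_pdivrMr// mulrC -ler_pdivrMr// ltW//.
  by have /andP[] := truncn_itv (divr_ge0 t0 (ltW d0)).
set h := t / m.+1%:R in md; have h0 : 0 <= h by rewrite divr_ge0.
suff grid n : forall k, u (n%:R * h) k <= e * (V k + 2 * (n%:R * h)).
  by have := grid m.+1 i; rewrite /h mulrC divfK.
elim: n => [k|n IH k].
  by rewrite mul0r mulr0 addr0 (le_trans (u0 k))// mulr_ge0// ltW.
have nh0 : 0 <= n%:R * h by rewrite mulr_ge0.
have [ks|ks] := boolP (k \in s); last first.
  rewrite (le_trans (uM _ _ _))//; first by rewrite mulr_ge0.
  have := sV _ ks; rewrite ler_pdivrMr// mulrC => /le_trans; apply.
  by rewrite (ler_wpM2l (ltW e0))// lerDl !mulr_ge0.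
have [|hq hu] := ds h _ k ks; first by rewrite h0.
rewrite -natr1 mulrDl mul1r (le_trans (hu _ nh0))//.
pose v l := e * (V l + 2 * (n%:R * h)).
rewrite -lerBrDr (le_trans (@ler_euler _ v h k h0 hq IH))// /v.
rewrite genZ genD gen_const addr0.
rewrite -subr_ge0 (_ : _ - _ = e * h * (1 - gen V k)); last by ring.
by rewrite !mulr_ge0 ?subr_ge0// ltW.
Qed.

(** The difference of the two solutions is at most 1 in either order, so the maximum principle
    applies to both differences. *)
Lemma backward_unique (V : T -> R) (u v : R -> T -> R) :
  (forall i, 0 <= V i) -> (forall i, gen V i <= 1) ->
  (forall r, exists s : seq T, forall i, i \notin s -> r <= V i) ->
  backward u -> backward v ->
  (forall t, 0 <= t -> unit_valued (u t)) ->
  (forall t, 0 <= t -> unit_valued (v t)) ->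
  (forall i, u 0 i = v 0 i) -> forall t i, 0 <= t -> u t i = v t i.
Proof.
move=> V0 VG Vs ub vb u1 v1 uv t i t0.
have le w z : backward w -> backward z ->
    (forall t, 0 <= t -> unit_valued (w t)) ->
    (forall t, 0 <= t -> unit_valued (z t)) ->
    (forall i, w 0 i = z 0 i) -> w t i <= z t i.
  move=> wb zb w1 z1 wz; rewrite -subr_le0.
  apply: (backward_le0 V0 VG Vs (backwardB wb zb) (M := 1)) => //.
    move=> s k s0; have /andP[_ wk] := w1 s s0 k; have /andP[zk _] := z1 s s0 k.
    by rewrite lerBlDr (le_trans wk)// lerDl.
  by move=> k; rewrite wz subrr.
by apply/eqP; rewrite eq_le !le.
Qed.

(** * Euler's method with estimates uniform in the step *)

(* Rows too fast for the step h are frozen, so that the step stays an average. *)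
Definition euler (h : R) (f : T -> R) (i : T) : R :=
  if 0 <= 1 + h * q i i then f i + h * gen f i else f i.

Definition euler_iter (h : R) (m : nat) (f : T -> R) : T -> R :=
  iter m (euler h) f.

(** Rows of [q] sum to zero, so the constants 0 and 1 are fixed by the step, which is monotone. *)
Lemma euler_unit h f : 0 <= h -> unit_valued f -> unit_valued (euler h f).
Proof.
move=> h0 f01 i; rewrite /euler; case: ifPn => // hq.
have f0 k : 0 <= f k by have /andP[] := f01 k.
have f1 k : f k <= 1 by have /andP[] := f01 k.
have := @ler_euler (fun=> 0) f h i h0 hq f0.
have := @ler_euler f (fun=> 1) h i h0 hq f1.
by rewrite !gen_const mulr0 !addr0 => -> ->.
Qed.

Lemma euler_iter_unit h m f : 0 <= h -> unit_valued f ->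
  unit_valued (euler_iter h m f).
Proof. by move=> h0 f01; elim: m => //= m; exact: euler_unit. Qed.

Lemma unit_norm f k : unit_valued f -> `|f k| <= 1.
Proof. by move=> /(_ k)/andP[f0 f1]; rewrite ger0_norm. Qed.

(** One step changes the value at [k] by at most [h * row_norm k], because the iterates stay in
    [0, 1]; a frozen row does not move. *)
Lemma euler_iter_drift h m s f k : 0 <= h -> unit_valued f ->
  `|euler_iter h (s + m) f k - euler_iter h m f k| <= s%:R * h * row_norm k.
Proof.
move=> h0 f01; elim: s => [|s IH]; first by rewrite subrr normr0 !mul0r.
set g := euler_iter h (s + m) f; have g01 : unit_valued g by exact: euler_iter_unit.
have -> : euler_iter h (s.+1 + m) f = euler h g by [].
rewrite (_ : _ - _ = euler h g k - g k + (g k - euler_iter h m f k)); last by ring.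
rewrite (le_trans (ler_normD _ _))//.
rewrite -natr1 2!mulrDl mul1r [leRHS]addrC lerD//.
rewrite /euler; case: ifPn => hq; last first.
  by rewrite subrr normr0 mulr_ge0// sumr_ge0.
rewrite addrC addrA addNr add0r normrM ger0_norm// ler_wpM2l//.
have := @ler_norm_gen g k 1 (fun l => unit_norm l g01).
by rewrite mulr1.
Qed.

(** A bound for [|gen (gen f) i|] when [|f| <= 1], hence for the second derivative of a solution. *)
Definition row_norm2 (i : T) : R := \sum_(k <- N i) `|q i k| * row_norm k.

(** Only row [i] has to be unfrozen, since the drift bound covers frozen neighbours. By induction on
    [r]: the next step adds an error of at most [row_norm2 i * r * h ^ 2], and
    [r ^ 2 + r <= (r + 1) ^ 2]. *)
Lemma euler_iter_quadratic h m r f i : 0 <= h -> 0 <= 1 + h * q i i ->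
  unit_valued f ->
  `|euler_iter h (r + m) f i - euler_iter h m f i
    - r%:R * h * gen (euler_iter h m f) i| <= row_norm2 i * (r%:R * h) ^+ 2.
Proof.
move=> h0 hq f01; set a := euler_iter h m f.
have C0 : 0 <= row_norm2 i.
  by rewrite sumr_ge0// => k _; rewrite mulr_ge0// sumr_ge0.
elim: r => [|r IH]; first by rewrite !mul0r subrr subr0 normr0 expr2 mul0r mulr0.
set g := euler_iter h (r + m) f.
have -> : euler_iter h (r.+1 + m) f i = g i + h * gen g i by rewrite /= /euler hq.
rewrite (_ : _ - _ - _ = (g i - a i - r%:R * h * gen a i) +
   h * (gen g i - gen a i)); last by rewrite -natr1; ring.
rewrite (le_trans (ler_normD _ _))//.
rewrite (@le_trans _ _ (row_norm2 i * (r%:R * h) ^+ 2 +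
   h * (r%:R * h * row_norm2 i)))//; last first.
  rewrite -subr_ge0 -natr1 (_ : _ - _ = row_norm2 i * (h ^+ 2 * (r%:R + 1))).
    by rewrite mulr_ge0// mulr_ge0// ?exprn_ge0// addr_ge0.
  by ring.
rewrite lerD// normrM ger0_norm// ler_wpM2l//.
rewrite -genB /gen (le_trans (ler_norm_sum _ _ _))// /row_norm2 mulr_sumr.
rewrite ler_sum// => k _; rewrite normrM mulrCA ler_wpM2l//.
exact: euler_iter_drift.
Qed.

(** Whether a row is frozen depends on [h] and [i] but not on the function, so the step is
    linear. *)
Lemma euler_sum h (s : seq T) (c : T -> R) (f : T -> T -> R) :
  euler h (fun k => \sum_(j <- s) c j * f j k) =
  fun i => \sum_(j <- s) c j * euler h (f j) i.
Proof.
apply/funext => i; rewrite /euler; case: ifPn => // _.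
rewrite (gen_sum s (fun j k => c j * f j k)) mulr_sumr -big_split/=.
by apply: eq_bigr => j _; rewrite genZ mulrDr mulrCA.
Qed.

Lemma euler_iter_sum h m (s : seq T) (c : T -> R) (f : T -> T -> R) :
  euler_iter h m (fun k => \sum_(j <- s) c j * f j k) =
  fun i => \sum_(j <- s) c j * euler_iter h m (f j) i.
Proof.
elim: m => //= m IH; rewrite /euler_iter/= in IH *.
by rewrite IH euler_sum.
Qed.

(** * The flow as an ultrafilter limit *)

(** One fixed ultrafilter gives limits for all times, functions and sites at once, compatible with
    finite sums; no subsequences are extracted. *)
Definition ultra_nat : set_system nat :=
  projT1 (cid (@ultraFilterLemma nat \oo _)).

#[local] Instance ultra_nat_ultra : UltraFilter ultra_nat.
Proof. by rewrite /ultra_nat; case: cid => U []. Qed.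

Lemma ultra_nat_oo : \oo `<=` ultra_nat.
Proof. by rewrite /ultra_nat; case: cid => U []. Qed.

(** Compactness of [0, 1] yields a cluster point, and a cluster point of an ultrafilter is a
    limit. *)
Lemma ultra_nat_cvg (u : nat -> R) : (forall n, 0 <= u n <= 1) ->
  cvg (u n @[n --> ultra_nat]).
Proof.
move=> u01; have [|a [_ ua]] := @segment_compact R 0 1 (u n @[n --> ultra_nat]).
- by apply: nearW => n /=; rewrite in_itv/=.
apply/cvg_ex; exists a => A aA; rewrite nbhs_filterE.
have [//|uA] := in_ultra_setVsetC (u @^-1` A) ultra_nat_ultra.
by have [x []] := ua (~` A) A uA aA.
Qed.

Definition flow_approx (t : R) (f : T -> R) (i : T) (n : nat) : R :=
  euler_iter n.+1%:R^-1 (Num.truncn (t * n.+1%:R)) f i.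

Definition flow (t : R) (f : T -> R) (i : T) : R :=
  lim (flow_approx t f i n @[n --> ultra_nat]).

Lemma flow_approx_unit t f i n : unit_valued f -> 0 <= flow_approx t f i n <= 1.
Proof. by move=> f01; apply: euler_iter_unit. Qed.

Lemma flow_cvg t f i : unit_valued f ->
  flow_approx t f i n @[n --> ultra_nat] --> flow t f i.
Proof. by move=> f01; apply: ultra_nat_cvg => n; exact: flow_approx_unit. Qed.

Lemma flow_unit t f : unit_valued f -> unit_valued (flow t f).
Proof.
move=> f01 i; have fc := @flow_cvg t f i f01; apply/andP; split.
  apply: (cvgr_to_ge fc); apply: nearW => n.
  by have /andP[] := flow_approx_unit t i n f01.
apply: (cvgr_to_le fc); apply: nearW => n.
by have /andP[] := flow_approx_unit t i n f01.
Qed.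

Lemma flow0 f i : flow 0 f i = f i.
Proof.
rewrite /flow (_ : flow_approx _ _ _ = fun=> f i) ?lim_cst//.
by apply/funext => n; rewrite /flow_approx mul0r truncn0.
Qed.

Lemma cvg_sum_seq (J I : Type) (F : set_system J) (FF : Filter F) (s : seq I)
    (u : J -> I -> R) (v : I -> R) :
  (forall k, u n k @[n --> F] --> v k) ->
  \sum_(k <- s) u n k @[n --> F] --> \sum_(k <- s) v k.
Proof.
move=> uv; elim: s => [|k s IH].
  rewrite big_nil; under eq_fun do rewrite big_nil.
  exact: cvg_cst.
rewrite big_cons; under eq_fun do rewrite big_cons.
exact: cvgD.
Qed.

Lemma cvg_gen (J : Type) (F : set_system J) (FF : Filter F) (u : J -> T -> R)
    (v : T -> R) i : (forall k, u n k @[n --> F] --> v k) ->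
  gen (u n) i @[n --> F] --> gen v i.
Proof.
by move=> uv; apply: cvg_sum_seq => k; apply: cvgM; [exact: cvg_cst|exact: uv].
Qed.

Lemma cvg_backward_le (J : Type) (F : set_system J) (FF : ProperFilter F)
    (u v : J -> T -> R) (u' v' : T -> R) (a b : J -> R) (a' b' : R) i :
  (forall k, u n k @[n --> F] --> u' k) -> v n i @[n --> F] --> v' i ->
  a n @[n --> F] --> a' -> b n @[n --> F] --> b' ->
  (\forall n \near F, `|v n i - u n i - a n * gen (u n) i| <= b n) ->
  `|v' i - u' i - a' * gen u' i| <= b'.
Proof.
move=> uu vv aa bb le; rewrite -subr_ge0.
have c : b n - `|v n i - u n i - a n * gen (u n) i| @[n --> F] -->
    b' - `|v' i - u' i - a' * gen u' i|.
  apply: cvgB => //; apply: cvg_norm; apply: cvgB; first exact: cvgB.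
  by apply: cvgM => //; exact: cvg_gen.
by apply: (cvgr_to_ge c); near=> n; rewrite subr_ge0; near: n.
Unshelve. all: by end_near. Qed.

Lemma flow_sum t (s : seq T) (c : T -> R) (f : T -> T -> R) i :
  (forall j, unit_valued (f j)) ->
  flow t (fun k => \sum_(j <- s) c j * f j k) i = \sum_(j <- s) c j * flow t (f j) i.
Proof.
move=> f01; rewrite /flow; apply/cvg_lim => //.
rewrite (_ : flow_approx _ _ _ = fun n => \sum_(j <- s) c j * flow_approx t (f j) i n).
  by apply: cvg_sum_seq => j; apply: cvgM; [exact: cvg_cst|exact: flow_cvg].
by apply/funext => n; rewrite /flow_approx euler_iter_sum.
Qed.

Lemma cvg_truncn (t : R) : 0 <= t ->
  (Num.truncn (t * n.+1%:R))%:R * n.+1%:R^-1 @[n --> \oo] --> t.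
Proof.
move=> t0; apply: (@squeeze_cvgr _ _ _ _ (fun n => t - n.+1%:R^-1) (fun=> t)).
- apply: nearW => n.
  have /andP[a b] := truncn_itv (mulr_ge0 t0 (ler0n R n.+1)).
  by rewrite ler_pdivrMr// a andbT ler_pdivlMr// mulrBl mulVf// lerBlDr natr1 ltW.
- rewrite -[X in _ --> X]subr0; apply: cvgB; first exact: cvg_cst.
  exact: cvg_harmonic.
- exact: cvg_cst.
Qed.

Lemma flow_quadratic t h f i : 0 <= t -> 0 <= h -> unit_valued f ->
  `|flow (t + h) f i - flow t f i - h * gen (flow t f) i| <= row_norm2 i * h ^+ 2.
Proof.
move=> t0 h0 f01.
(* The number of Euler steps between the grid times just below [t] and [t + h]. *)
pose r n := (Num.truncn ((t + h) * n.+1%:R) - Num.truncn (t * n.+1%:R))%N.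
have th n : (Num.truncn (t * n.+1%:R) <= Num.truncn ((t + h) * n.+1%:R))%N.
  by rewrite le_truncn// ler_wpM2r// lerDl.
have rh : (r n)%:R * n.+1%:R^-1 @[n --> ultra_nat] --> h.
  have rh : (r n)%:R * n.+1%:R^-1 @[n --> \oo] --> h.
    rewrite -[X in _ --> X](addKr t) addrC.
    under eq_fun do rewrite /r natrB// mulrBl.
    by apply: cvgB; apply: cvg_truncn => //; rewrite addr_ge0.
  by move=> A hA; exact: ultra_nat_oo (rh A hA).
apply: (@cvg_backward_le nat ultra_nat _ (fun n k => flow_approx t f k n)
  (fun n k => flow_approx (t + h) f k n) (flow t f) (flow (t + h) f)
  (fun n => (r n)%:R * n.+1%:R^-1)
  (fun n => row_norm2 i * ((r n)%:R * n.+1%:R^-1) ^+ 2)) => //.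
- by move=> k; exact: flow_cvg.
- exact: flow_cvg.
- apply: cvgM; first exact: cvg_cst.
  by rewrite expr2; under eq_fun do rewrite expr2; exact: cvgM.
(* For large [n] the step is so small that row [i] is not frozen. *)
have [d d0 dq] := euler_small i.
apply: ultra_nat_oo.
have := @near_infty_natSinv_lt R (PosNum d0); apply: filterS => n /= nd.
have := @euler_iter_quadratic n.+1%:R^-1 (Num.truncn (t * n.+1%:R)) (r n) f i.
rewrite /r subnK//; apply=> //.
by apply: dq; rewrite invr_ge0 ler0n ltW.
Qed.

(** * The kernel of the flow *)

Definition delta (j : T) : T -> R := fun k => (k == j)%:R.

Lemma delta_unit j : unit_valued (delta j).
Proof. by move=> k; rewrite /delta; case: eqP; rewrite ?lexx ?ler01. Qed.

Definition flow_kernel (t : R) (i j : T) : R := flow t (delta j) i.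

Lemma flow_kernel_backward j : backward (fun t i => flow_kernel t i j).
Proof.
apply: (@backward_quadratic row_norm2) => t h i t0 h0.
exact: flow_quadratic (delta_unit j).
Qed.

Lemma flow_kernel_quadratic h i j : 0 <= h ->
  `|flow_kernel h i j - (i == j)%:R - h * q i j| <= row_norm2 i * h ^+ 2.
Proof.
move=> h0; have := flow_quadratic i (lexx 0) h0 (delta_unit j).
rewrite add0r flow0 (_ : flow 0 _ = delta j) ?gen_delta//.
by apply/funext => k; rewrite flow0.
Qed.

(** By linearity the partial sums are flows started from truncations of [f]. Their increasing limit
    solves the backward equation from [f], hence equals [v] by uniqueness. *)
Lemma esum_flow_kernel (V : T -> R) (f : T -> R) (v : R -> T -> R) :
  (forall i, 0 <= V i) -> (forall i, gen V i <= 1) ->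
  (forall r, exists s : seq T, forall i, i \notin s -> r <= V i) ->
  unit_valued f -> backward v -> (forall t, 0 <= t -> unit_valued (v t)) ->
  (forall i, v 0 i = f i) -> forall t i, 0 <= t ->
  (\esum_(j in [set: T]) (flow_kernel t i j * f j)%:E = (v t i)%:E)%E.
Proof.
move=> V0 VG Vs f01 vb v01 vf t i t0.
have f0 j : 0 <= f j by have /andP[] := f01 j.
pose F n k := \sum_(j <- first_elements T n) f j * delta j k.
have FE n k : F n k = if k \in first_elements T n then f k else 0.
  case: ifPn => kn; rewrite /F.
    rewrite (bigD1_seq k)//= ?first_elements_uniq// /delta eqxx mulr1.
    by rewrite big1 ?addr0// => j jk; rewrite eq_sym (negPf jk) mulr0.
  rewrite big_seq big1// => j jn; rewrite /delta.
  by case: eqP kn jn => [-> /negPf ->//|_ _ _]; rewrite mulr0.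
have F01 n : unit_valued (F n).
  by move=> k; rewrite FE; case: ifP => // _; rewrite lexx ler01.
have PF n s k : \sum_(j <- first_elements T n) flow_kernel s k j * f j = flow s (F n) k.
  rewrite /F flow_sum//; last exact: delta_unit.
  by apply: eq_bigr => j _; rewrite mulrC.
have kf0 s k j : 0 <= flow_kernel s k j * f j.
  by rewrite mulr_ge0//; have /andP[] := flow_unit s (delta_unit j) k.
pose G s k := limn (fun n => flow s (F n) k).
have Gc s k : flow s (F n) k @[n --> \oo] --> G s k.
  apply: nondecreasing_is_cvgn.
    by move=> n m nm; rewrite -!PF ler_sum_first_elements.
  by exists 1 => _ [n _ <-]; have /andP[] := flow_unit s (F01 n) k.
suff -> : v t i = G t i.
  apply: esum_first_elements => //.
  by under eq_fun do rewrite PF; exact: Gc.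
symmetry; apply: (backward_unique V0 VG Vs) => //.
(* The constant in the second order estimate does not depend on the truncation, so the estimate
   survives the limit. *)
- apply: (@backward_quadratic row_norm2) => s h k s0 h0.
  apply: (@cvg_backward_le nat \oo _ (fun n => flow s (F n))
    (fun n => flow (s + h) (F n)) (G s) (G (s + h)) (fun=> h)
    (fun=> row_norm2 k * h ^+ 2)) => //.
  + exact: cvg_cst.
  + exact: cvg_cst.
  + by apply: nearW => n; exact: flow_quadratic.
- move=> s s0 k; apply/andP; split.
    by apply: (cvgr_to_ge (Gc s k)); apply: nearW => n; have /andP[] := flow_unit s (F01 n) k.
  by apply: (cvgr_to_le (Gc s k)); apply: nearW => n; have /andP[] := flow_unit s (F01 n) k.
- move=> k; rewrite vf; apply/cvg_lim => //.
  apply: cvg_near_cst; exists (pickle k).+1 => // n /= kn.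
  by rewrite flow0 FE (sub_first_elements kn)// mem_first_elements.
Qed.

End Generator.

(** * Existence of the transition matrix *)

Section Existence.
Context {R : realType} (q : int -> int -> R) (N : int -> seq int).
Context (q_ge0 : forall i k, k != i -> 0 <= q i k)
  (q_out : forall i k, k \notin N i -> q i k = 0)
  (N_uniq : forall i, uniq (N i)) (N_self : forall i, i \in N i)
  (q_sum0 : forall i, \sum_(k <- N i) q i k = 0).

Lemma flow_kernel_has_qmatrix : has_qmatrix (flow_kernel q N) q.
Proof.
move=> i j; apply/cvgrPdist_le => e e0.
have C0 : 0 < `|row_norm2 q N i| + 1 by rewrite ltr_wpDl.
near=> t.
have t0 : 0 < t by near: t; exact: nbhs_right_gt.
have te : t <= e / (`|row_norm2 q N i| + 1).
  by near: t; apply: nbhs_right_le; rewrite divr_gt0.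
have kt := flow_kernel_quadratic q_ge0 q_out N_uniq N_self q_sum0 i j (ltW t0).
rewrite distrC (_ : _ / t - _ =
  (flow_kernel q N t i j - (i == j)%:R - t * q i j) / t); last by field; exact: lt0r_neq0.
rewrite normrM [`|t^-1|]gtr0_norm ?invr_gt0// ler_pdivrMr// (le_trans kt)//.
rewrite expr2 mulrA ler_pM2r//; move: te; rewrite ler_pdivlMr// mulrC.
apply: le_trans; rewrite ler_wpM2r ?(ltW t0)//.
by rewrite (le_trans (ler_norm _))// lerDl.
Unshelve. all: by end_near. Qed.

Lemma has_qmatrix_standard (p : R -> int -> int -> R) i j :
  has_qmatrix p q -> p t i j @[t --> 0^'+] --> ((i == j)%:R : R).
Proof.
move=> pq; have idc : t @[t --> (0:R)^'+] --> (0 : R).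
  by apply: cvg_at_right_filter; exact: cvg_id.
have c : (i == j)%:R + t * ((p t i j - (i == j)%:R) / t) @[t --> 0^'+] -->
    (i == j)%:R + 0 * q i j.
  by apply: cvgD; [exact: cvg_cst|apply: cvgM => //; exact: pq].
rewrite mul0r addr0 in c; apply: cvg_trans c; apply: near_eq_cvg.
near=> t; have t0 : t != 0.
  by apply: lt0r_neq0; near: t; exact: nbhs_right_gt.
by rewrite mulrCA divff// mulr1 addrC subrK.
Unshelve. all: by end_near. Qed.

Context (V : int -> R) (V_ge0 : forall i, 0 <= V i)
  (V_gen : forall i, gen q N V i <= 1)
  (V_fin : forall r, exists s : seq int, forall i, i \notin s -> r <= V i).

Lemma flow_kernel_transition_matrix : transition_matrix (flow_kernel q N).
Proof.
have ku t j : unit_valued (fun i => flow_kernel q N t i j).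
  by move=> i; exact: (flow_unit q_ge0 N_uniq N_self q_sum0 t (delta_unit j)).
split.
- by move=> t i j _; have /andP[] := ku t j i.
(* Total mass: the constant 1 solves the backward equation from 1. *)
- move=> t i t0.
  under eq_esum do rewrite -[flow_kernel q N t i _]mulr1.
  apply: (esum_flow_kernel q_ge0 N_uniq N_self q_sum0 V_ge0 V_gen V_fin
    (f := fun=> 1) (v := fun _ _ => 1)) => //.
  + by move=> k; rewrite ler01 lexx.
  + move=> k e e0; exists 1 => // s h s0 /andP[h0 _].
    by rewrite gen_const// mulr0 subrr subr0 normr0 mulr_ge0// ltW.
  + by move=> s s0 k; rewrite ler01 lexx.
(* Semigroup property: a column shifted in time by [t] solves the backward equation from its value
   at time [t]. *)
- move=> s t i j s0 t0; symmetry.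
  apply: (esum_flow_kernel q_ge0 N_uniq N_self q_sum0 V_ge0 V_gen V_fin
    (f := fun k => flow_kernel q N t k j) (v := fun s i => flow_kernel q N (s + t) i j)) => //.
  + move=> k e e0.
    have [d d0 kd] := flow_kernel_backward q_ge0 N_uniq N_self q_sum0 j k e0.
    exists d => // r h r0 hd.
    by rewrite (addrAC r h t); exact: kd (addr_ge0 r0 t0) hd.
  + by move=> k; rewrite add0r.
- by move=> i j; apply: has_qmatrix_standard; exact: flow_kernel_has_qmatrix.
Qed.

(** * Uniqueness of the transition matrix *)

Context (p : R -> int -> int -> R) (p_tm : transition_matrix p)
  (p_q : has_qmatrix p q).

Lemma transition_row_le1 t i (s : seq int) : 0 <= t -> uniq s ->
  \sum_(k <- s) p t i k <= 1.
Proof.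
move=> t0 us; rewrite -lee_fin -(tm_sum1 p_tm i t0).
have /(_ (fun k => `|p t i k|) s (fun=> normr_ge0 _) us) := @le_sum_esum R int.
under eq_bigr do rewrite ger0_norm ?(tm_ge0 p_tm)//.
by under eq_esum do rewrite ger0_norm ?(tm_ge0 p_tm)//.
Qed.

Lemma transition_unit t j : 0 <= t -> unit_valued (fun i => p t i j).
Proof.
move=> t0 i; rewrite (tm_ge0 p_tm)//=.
by have := @transition_row_le1 t i [:: j] t0 isT; rewrite big_seq1.
Qed.

Lemma transition_sum_le s t i j (l : seq int) : 0 <= s -> 0 <= t -> uniq l ->
  \sum_(k <- l) p s i k * p t k j <= p (s + t) i j.
Proof.
move=> s0 t0 ul; rewrite -lee_fin (tm_semigroup p_tm i j s0 t0).
apply: (@le_sum_esum R int (fun k => p s i k * p t k j)) => // k.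
by rewrite mulr_ge0// (tm_ge0 p_tm).
Qed.

(** Since rows have mass one, the semigroup property also holds for the complements [1 - p]. This
    gives upper bounds on [p (s + t) i j], where [transition_sum_le] gives lower ones. *)
Lemma transition_compl_sum_le s t i j (l : seq int) :
  0 <= s -> 0 <= t -> uniq l ->
  \sum_(k <- l) p s i k * (1 - p t k j) <= 1 - p (s + t) i j.
Proof.
move=> s0 t0 ul.
have a0 k : 0 <= p s i k * p t k j by rewrite mulr_ge0// (tm_ge0 p_tm).
have b0 k : 0 <= p s i k * (1 - p t k j).
  rewrite mulr_ge0// ?(tm_ge0 p_tm)// subr_ge0.
  by have /andP[] := transition_unit j t0 k.
have := @esumD R int setT (fun k => (p s i k * p t k j)%:E)
  (fun k => (p s i k * (1 - p t k j))%:E).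
rewrite -(tm_semigroup p_tm i j s0 t0).
under eq_esum do rewrite -EFinD -mulrDr addrC subrK mulr1.
rewrite (tm_sum1 p_tm i s0) => E.
have {}E := E (fun k _ => a0 k) (fun k _ => b0 k).
by rewrite -lee_fin EFinB E addrAC subee// add0e; exact: le_sum_esum.
Qed.

(** Standardness fixes only the limit at [0^'+]. Letting [t] tend to 0 in
    [p 0 i k * p t k k <= p t i k] kills the off-diagonal entries, and total mass one fixes the
    diagonal. *)
Lemma transition0 i j : p 0 i j = (i == j)%:R.
Proof.
have le k : p 0 i k <= (i == k)%:R.
  have c : p t i k - p 0 i k * p t k k @[t --> 0^'+] -->
      (i == k)%:R - p 0 i k * (k == k)%:R.
    apply: cvgB; first exact: (tm_standard p_tm).
    by apply: cvgM; [exact: cvg_cst|exact: (tm_standard p_tm)].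
  rewrite -subr_ge0; rewrite eqxx mulr1 in c; apply: (cvgr_to_ge c).
  near=> t; have t0 : 0 <= t by apply: ltW; near: t; exact: nbhs_right_gt.
  rewrite subr_ge0.
  have := @transition_sum_le 0 t i k [:: k] (lexx 0) t0 isT.
  by rewrite big_seq1 add0r.
have z k : i != k -> p 0 i k = 0.
  move=> ik; apply/eqP; rewrite eq_le (tm_ge0 p_tm)// andbT.
  by have := le k; rewrite (negPf ik).
have [<-|/z//] := eqVneq i j.
have : (\esum_(k in [set: int]) (p 0 i k)%:E = (p 0 i i)%:E)%E.
  apply: esum_first_elements => [k|]; first exact: (tm_ge0 p_tm).
  apply: cvg_near_cst; exists (pickle i).+1 => // n /= ni.
  rewrite (bigD1_seq i)/= ?first_elements_uniq//; last first.
    by apply: (sub_first_elements ni); exact: mem_first_elements.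
  by rewrite big1 ?addr0// => k ki; rewrite z// eq_sym.
by rewrite (tm_sum1 p_tm)// => -[<-].
Unshelve. all: by end_near. Qed.

Lemma transition_near0 i k (e : R) : 0 < e -> exists2 d : R, 0 < d &
  forall h, 0 <= h <= d -> `|p h i k - (i == k)%:R - h * q i k| <= e * h.
Proof.
move=> e0; have /cvgrPdist_le/(_ e e0) := @p_q i k.
rewrite near_withinE => /nbhs_ballP[d /= d0 dp].
exists (d / 2); first by rewrite divr_gt0.
move=> h /andP[]; rewrite le_eqVlt => /predU1P[<- _|h0 hd].
  by rewrite transition0 subrr mul0r subr0 normr0 mulr0.
have := dp h; rewrite /ball/= sub0r normrN gtr0_norm//.
have -> : h < d by rewrite (le_lt_trans hd)// ltr_pdivrMr// ltr_pMr// ltr1n.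
move=> /(_ isT h0) H.
rewrite (_ : _ - _ - _ = - (q i k - (p h i k - (i == k)%:R) / h) * h); last first.
  by field; exact: lt0r_neq0.
by rewrite normrM normrN (gtr0_norm h0) ler_wpM2r// ltW.
Qed.

(* Since the rows of q sum to zero and p is honest, the mass that leaves the
   neighbourhood of i in time h is o(h). *)
Lemma transition_backward j : backward q N (fun t i => p t i j).
Proof.
move=> i e e0.
(* The error [e * h] is shared among the neighbours; the successor keeps [c] positive. *)
pose c : R := (size (N i)).+1%:R.
have c0 : 0 < c by rewrite ltr0n.
have [d d0 dp] : exists2 d : R, 0 < d & forall h, 0 <= h <= d ->
    forall k, k \in N i -> `|p h i k - (i == k)%:R - h * q i k| <= e / c * h.
  elim: (N i) => [|k s [d d0 IH]]; first by exists 1.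
  have [d1 d10 d1p] := transition_near0 i k (divr_gt0 e0 c0).
  exists (Num.min d d1); first by rewrite lt_min d0.
  move=> h /andP[h0]; rewrite le_min => /andP[hd hd1] l.
  rewrite inE => /predU1P[->|ls]; first by rewrite d1p// h0.
  by apply: IH => //; rewrite h0.
exists d => // t h t0 hd; have /andP[h0 _] := hd.
pose r k := p h i k - (i == k)%:R - h * q i k.
have rle (F : int -> R) : unit_valued F -> `|\sum_(k <- N i) r k * F k| <= e * h.
  move=> F01; rewrite (le_trans (ler_norm_sum _ _ _))//.
  apply: (@le_trans _ _ (\sum_(k <- N i) e / c * h)).
    rewrite big_seq [leRHS]big_seq ler_sum// => k kN.
    by rewrite normrM -[leRHS]mulr1 ler_pM// ?dp// unit_norm.
  rewrite big_const_seq count_predT iter_addr_0 -mulr_natl mulrA ler_wpM2r//.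
  by rewrite mulrCA ger_pMr// ler_pdivrMr// mul1r ler_nat.
have sumE (F : int -> R) : \sum_(k <- N i) p h i k * F k =
    F i + h * gen q N F i + \sum_(k <- N i) r k * F k.
  rewrite -(big_neighbours N_uniq N_self i F) /gen mulr_sumr -!big_split/=.
  by apply: eq_bigr => k _; rewrite /r; ring.
pose u k := p t k j; pose u' k := 1 - u k.
have u01 : unit_valued u by exact: transition_unit.
have u'01 : unit_valued u'.
  by move=> k; have /andP[u0 u1] := u01 k; rewrite /u' subr_ge0 u1 gerBl.
(* Because [gen] of [1 - u] is minus [gen] of [u], the lower bounds for [u] and for [1 - u] enclose
   the increment from both sides. *)
have := transition_sum_le i j h0 t0 (N_uniq i).
have := transition_compl_sum_le i j h0 t0 (N_uniq i).
rewrite (sumE u') (sumE u) (genB q N (fun=> 1)) gen_const// sub0r [h + t]addrC.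
have := rle u u01; have := rle u' u'01; rewrite !ler_norml /u' /u.
move=> /andP[a1 a2] /andP[b1 b2] c1 c2; apply/andP; split; lra.
Qed.

Lemma transition_unique t i j : 0 <= t -> p t i j = flow_kernel q N t i j.
Proof.
move=> t0; apply: (backward_unique q_ge0 N_uniq N_self q_sum0 V_ge0 V_gen V_fin
    (u := fun t i => p t i j) (v := fun t i => flow_kernel q N t i j)) => //.
- exact: transition_backward.
- exact: flow_kernel_backward.
- by move=> s s0; exact: transition_unit.
- by move=> s _ k; exact: (flow_unit q_ge0 N_uniq N_self q_sum0 s (delta_unit j)).
- by move=> k; rewrite transition0 /flow_kernel flow0.
Qed.

End Existence.

(** * The Q-matrix of a fixed environment *)

Section Walk.
Context {R : realType} {L : nat} (w : env R L).

Definition neighbours (i : int) : seq int :=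
  [:: i + 1, i & [seq i - (l.+1)%:Z | l : 'I_L <- enum 'I_L]].

Lemma lambda_ge0 i : 0 <= lambda w i.
Proof. exact: set_mem (valP w) i ord_max. Qed.

Lemma mu_ge0 i l : 0 <= mu w i l.
Proof. exact: set_mem (valP w) i _. Qed.

Lemma lambda_le_rate i : lambda w i <= rate w i.
Proof. by rewrite lerDl sumr_ge0// => l _; exact: mu_ge0. Qed.

Lemma sum_mu_le_rate i : \sum_(l < L) mu w i l <= rate w i.
Proof. by rewrite lerDr lambda_ge0. Qed.

Lemma rate_le_block_rate n (k : 'I_L) :
  rate w (n * L%:Z - (k.+1)%:Z) <= block_rate w n.
Proof. exact: le_bigmax. Qed.

Lemma qmatrix_ge0 i k : k != i -> 0 <= qmatrix w i k.
Proof.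
rewrite /qmatrix => ki; case: ifP => _; first exact: lambda_ge0.
by rewrite (negPf ki) sumr_ge0// => l _; exact: mu_ge0.
Qed.

Lemma qmatrix_out i k : k \notin neighbours i -> qmatrix w i k = 0.
Proof.
rewrite !inE !negb_or => /and3P[/negPf ki1 /negPf ki /mapP kN].
rewrite /qmatrix ki1 ki big1// => l /eqP kl.
by case: kN; exists l; rewrite ?mem_enum.
Qed.

Lemma neighbours_uniq i : uniq (neighbours i).
Proof.
rewrite /= inE negb_or; apply/and3P; split.
- apply/andP; split; first by lia.
  by apply/mapP => -[l _]; lia.
- by apply/mapP => -[l _]; lia.
- rewrite map_inj_uniq ?enum_uniq// => l m.
  by move=> lm; apply/val_inj => /=; lia.
Qed.

Lemma neighbours_self i : i \in neighbours i.
Proof. by rewrite !inE eqxx orbT. Qed.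

(** The diagonal entry, minus the total rate, is distributed over the jumps and turns values into
    differences. *)
Lemma gen_neighbours f i : gen (qmatrix w) neighbours f i =
  lambda w i * (f (i + 1) - f i) +
  \sum_(l < L) mu w i l * (f (i - (l.+1)%:Z) - f i).
Proof.
have qm (l : 'I_L) : qmatrix w i (i - (l.+1)%:Z) = mu w i l.
  rewrite /qmatrix.
  have /negPf-> : i - (l.+1)%:Z != i + 1 by lia.
  have /negPf-> : i - (l.+1)%:Z != i by lia.
  rewrite (big_pred1 l)// => m; apply/eqP/eqP => [lm|->//].
  by apply/val_inj => /=; lia.
rewrite /gen !big_cons big_map big_enum /=.
under eq_bigr do rewrite qm.
rewrite /qmatrix !eqxx; have /negPf-> : i != i + 1 by lia.
rewrite /rate; under [in RHS]eq_bigr do rewrite mulrBr.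
by rewrite sumrB -mulr_suml; ring.
Qed.

Lemma qmatrix_sum0 i : \sum_(k <- neighbours i) qmatrix w i k = 0.
Proof.
have := gen_neighbours (fun=> 1) i; rewrite /gen.
under eq_bigr do rewrite mulr1.
by move=> ->; rewrite subrr mulr0 add0r big1// => l _; rewrite mulr0.
Qed.

(** * The Lyapunov function of the walk *)

(* On the block of sites -(b L + k), 1 <= k <= L, the value is constant; since
   a jump to the left enters at most the next block, it increases the value by
   at most the inverse of block_rate w (- b). *)
Definition lyapunov (i : int) : R :=
  match i with
  | Posz n => \sum_(1 <= m < n) (rate w m%:Z)^-1
  | Negz n => \sum_(0 <= b < n %/ L) (block_rate w (- b%:Z))^-1
  end.

Context (L_gt0 : (0 < L)%N) (rate_gt0 : forall i, 0 < rate w i).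

Lemma block_rate_gt0 n : 0 < block_rate w n.
Proof. exact: lt_le_trans (rate_gt0 _) (rate_le_block_rate n (Ordinal L_gt0)). Qed.

Lemma lyapunov_ge0 i : 0 <= lyapunov i.
Proof.
case: i => n /=; rewrite sumr_ge0// => m _; rewrite invr_ge0 ltW//.
exact: block_rate_gt0.
Qed.

Lemma ler_sum_inv (r : nat -> R) k m n : (forall i, 0 < r i) -> (m <= n)%N ->
  \sum_(k <= i < m) (r i)^-1 <= \sum_(k <= i < n) (r i)^-1.
Proof.
move=> r0 mn; have [km|mk] := leqP k m.
  by rewrite [leRHS](@big_cat_nat _ _ _ m)//= lerDl sumr_ge0// => i _; rewrite invr_ge0 ltW.
by rewrite big_geq ?(ltnW mk)// sumr_ge0// => i _; rewrite invr_ge0 ltW.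
Qed.

Lemma ler_lyapunov_Posz m n : (m <= n)%N -> lyapunov m%:Z <= lyapunov n%:Z.
Proof. by move=> mn; apply: (@ler_sum_inv (fun m => rate w m%:Z)). Qed.

Lemma ler_lyapunov_Negz m n : (m <= n)%N -> lyapunov (Negz m) <= lyapunov (Negz n).
Proof.
move=> mn; apply: (@ler_sum_inv (fun b => block_rate w (- b%:Z))).
  by move=> b; exact: block_rate_gt0.
exact: leq_div2r.
Qed.

(** From [n >= 1] the sum gains exactly the term of [n]; from 0 it stays empty, as it starts at 1;
    on the negative side the value does not increase. *)
Lemma lyapunov_right i : lyapunov (i + 1) - lyapunov i <= (rate w i)^-1.
Proof.
have i0 : 0 <= (rate w i)^-1 by rewrite invr_ge0 ltW.
case: i i0 => [n|[|n]] i0.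
- have -> : n%:Z + 1 = n.+1%:Z by lia.
  case: n i0 => [|n] i0 /=; first by rewrite !big_geq// subrr.
  by rewrite big_nat_recr//= addrAC subrr add0r.
- have -> : Negz 0 + 1 = 0%:Z by lia.
  by rewrite /= div0n !big_geq// subrr.
- have -> : Negz n.+1 + 1 = Negz n by lia.
  by rewrite (le_trans _ i0)// subr_le0 ler_lyapunov_Negz.
Qed.

Lemma lyapunov_left i (l : 'I_L) :
  lyapunov (i - (l.+1)%:Z) - lyapunov i <= if i is Negz _ then (rate w i)^-1 else 0.
Proof.
case: i => n.
- rewrite subr_le0; have [ln|nl] := ltnP l n.
    have -> : n%:Z - l.+1%:Z = (n - l.+1)%:Z by lia.
    by apply: ler_lyapunov_Posz; lia.
  (* A jump across 0 lands in the first block on the left, where the function vanishes. *)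
  have -> : n%:Z - l.+1%:Z = Negz (l - n) by lia.
  rewrite [leLHS]/= divn_small ?big_geq ?lyapunov_ge0//.
  exact: leq_ltn_trans (leq_subr _ _) (ltn_ord l).
- have -> : Negz n - l.+1%:Z = Negz (n + l.+1) by lia.
  apply: (@le_trans _ _ (block_rate w (- (n %/ L)%:Z))^-1).
    rewrite lerBlDr (@le_trans _ _ (lyapunov (Negz (n + L))))//.
      by apply: ler_lyapunov_Negz; rewrite leq_add2l.
    by rewrite /= divnDr// divnn L_gt0 addn1 big_nat_recr//= addrC.
  rewrite lef_pV2 ?posrE ?block_rate_gt0//.
  (* [Negz n] is the site [- (n %/ L) * L - (n %% L + 1)], so its own rate is among those maximised
     in [block_rate]. *)
  have nL : (n %% L < L)%N by rewrite ltn_mod.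
  have := rate_le_block_rate (- (n %/ L)%:Z) (Ordinal nL).
  rewrite (_ : _ - _ = Negz n)//= NegzE.
  by have := divn_eq n L; lia.
Qed.

(** On each half-line only outward jumps can raise the value, by at most the inverse of [rate w i],
    and their total rate is at most [rate w i]. *)
Lemma gen_lyapunov_le1 i : gen (qmatrix w) neighbours lyapunov i <= 1.
Proof.
rewrite gen_neighbours.
have r0 := ltW (rate_gt0 i).
have i0 : 0 <= (rate w i)^-1 by rewrite invr_ge0.
case: i r0 i0 => n r0 i0.
- apply: (@le_trans _ _ (rate w n%:Z * (rate w n%:Z)^-1 + 0)).
    rewrite lerD//.
      apply: (@le_trans _ _ (lambda w n * (rate w n%:Z)^-1)).
        by rewrite ler_wpM2l ?lambda_ge0 ?lyapunov_right.
      by rewrite ler_wpM2r ?lambda_le_rate.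
    rewrite sumr_le0// => l _.
    by rewrite mulr_ge0_le0 ?mu_ge0//; exact: (lyapunov_left n%:Z).
  by rewrite addr0 mulfV// lt0r_neq0.
- apply: (@le_trans _ _ (0 + rate w (Negz n) * (rate w (Negz n))^-1)).
    rewrite lerD//.
      rewrite mulr_ge0_le0 ?lambda_ge0// subr_le0.
      case: {r0 i0} n => [|n].
        have -> : Negz 0 + 1 = 0%:Z by lia.
        by rewrite [leLHS]/= big_geq ?lyapunov_ge0.
      have -> : Negz n.+1 + 1 = Negz n by lia.
      exact: ler_lyapunov_Negz.
    apply: (@le_trans _ _ (\sum_(l < L) mu w (Negz n) l * (rate w (Negz n))^-1)).
      apply: ler_sum => l _; rewrite ler_wpM2l ?mu_ge0//.
      exact: (lyapunov_left (Negz n)).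
    by rewrite -mulr_suml ler_wpM2r// sum_mu_le_rate.
  by rewrite add0r mulfV// lt0r_neq0.
Qed.

Lemma nneseries_inv_unbounded (r : nat -> R) k : (forall n, 0 < r n) ->
  (\sum_(k <= n <oo) ((r n)%:E)^-1 = +oo)%E ->
  forall M : R, exists n, M <= \sum_(k <= i < n) (r i)^-1.
Proof.
move=> r0 roo M; apply: contrapT => /forallNP nM.
have : (\sum_(k <= n <oo) ((r n)%:E)^-1 <= M%:E)%E.
  apply: lime_le.
    apply: is_cvg_ereal_nneg_natsum => n _.
    by rewrite inver gt_eqF// lee_fin invr_ge0 ltW.
  apply: nearW => n; have /negP := nM n; rewrite -ltNge => /ltW.
  rewrite -lee_fin -sumEFin; apply: le_trans; rewrite le_eqVlt; apply/orP; left.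
  by apply/eqP/eq_bigr => i _; rewrite inver gt_eqF.
by rewrite roo.
Qed.

Lemma lyapunov_unbounded :
  (\sum_(1 <= n <oo) ((rate w n%:Z)%:E)^-1 = +oo)%E ->
  (\sum_(0 <= n <oo) ((block_rate w (- n%:Z))%:E)^-1 = +oo)%E ->
  forall M, exists s : seq int, forall i, i \notin s -> M <= lyapunov i.
Proof.
move=> roo boo M.
have [m mM] := @nneseries_inv_unbounded (fun n => rate w n%:Z) 1%N (fun=> rate_gt0 _) roo M.
have [n nM] := @nneseries_inv_unbounded (fun n => block_rate w (- n%:Z)) 0%N
  (fun=> block_rate_gt0 _) boo M.
(* The first [n] blocks on the left consist of [n * L] sites; beyond these sites monotonicity keeps
   the value above [M]. *)
exists ([seq k%:Z | k <- iota 0 m] ++ [seq Negz k | k <- iota 0 (n * L)]) => i.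
rewrite mem_cat negb_or => /andP[iP iN].
case: i iP iN => k iP iN.
  apply: le_trans mM (ler_lyapunov_Posz _); rewrite leqNgt.
  by apply: contra iP => km; apply: map_f; rewrite mem_iota.
apply: le_trans nM _.
apply: (@ler_sum_inv (fun b => block_rate w (- b%:Z))).
  by move=> b; exact: block_rate_gt0.
rewrite leq_divRL// leqNgt.
by apply: contra iN => km; apply: map_f; rewrite mem_iota.
Qed.

Lemma qmatrix_regular :
  (\sum_(1 <= n <oo) ((rate w n%:Z)%:E)^-1 = +oo)%E ->
  (\sum_(0 <= n <oo) ((block_rate w (- n%:Z))%:E)^-1 = +oo)%E ->
  exists p : R -> int -> int -> R,
    [/\ transition_matrix p, has_qmatrix p (qmatrix w) &
      forall p' : R -> int -> int -> R,
        transition_matrix p' -> has_qmatrix p' (qmatrix w) ->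
        forall (t : R) (i j : int), 0 <= t -> p' t i j = p t i j].
Proof.
move=> roo boo; exists (flow_kernel (qmatrix w) neighbours).
have Vfin := lyapunov_unbounded roo boo.
have q0 := qmatrix_ge0; have qo := qmatrix_out; have Nu := neighbours_uniq.
have Ns := neighbours_self; have qs := qmatrix_sum0.
split.
- exact: (flow_kernel_transition_matrix q0 qo Nu Ns qs lyapunov_ge0 gen_lyapunov_le1 Vfin).
- exact: (flow_kernel_has_qmatrix q0 qo Nu Ns qs).
- move=> p' tm pq t i j t0.
  exact: (transition_unique q0 Nu Ns qs lyapunov_ge0 gen_lyapunov_le1 Vfin tm pq).
Qed.

End Walk.

(** * Measurability and almost sure positivity of the rates *)

Section Measurability.
Context {R : realType} {L : nat}.

Lemma continuous_site i : continuous (site i : env R L -> 'rV[R]_L.+1).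
Proof.
move=> w; apply: (@continuous_comp _ {ptws int -> 'rV[R]_L.+1} _ set_val (proj i)).
  exact: initial_continuous.
exact: proj_continuous.
Qed.

(** The rate as a function of one site's vector, so that equality in law of the sites applies to
    it. *)
Definition vector_rate (v : 'rV[R]_L.+1) : R :=
  v 0 ord_max + \sum_(l < L) v 0 (lift ord_max (rev_ord l)).

Lemma continuous_vector_rate : continuous vector_rate.
Proof.
move=> v; apply: continuousD; first exact: coord_continuous.
apply: (cvg_sum_seq (nbhs_filter v)) => l; exact: coord_continuous.
Qed.

Lemma measurable_rate i :
  measurable_fun setT (fun w : borel (env R L) => rate w i).
Proof.
have c : continuous (fun w : env R L => rate w i).
  move=> w; apply: (@continuous_comp _ _ _ (site i) vector_rate).
    exact: continuous_site.
  exact: continuous_vector_rate.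
apply: (measurability _ (RGenOpens.measurableE R)) => //.
move=> _ [_ [a [b ->] <-]]; rewrite setTI; apply: sub_gen_smallest.
by move/continuousP : c; apply; exact: interval_open.
Qed.

Lemma measurable_block_rate n :
  measurable_fun setT (fun w : borel (env R L) => block_rate w n).
Proof.
rewrite /block_rate; elim: (index_enum _) => [|k s IH].
  by under eq_fun do rewrite big_nil; exact: measurable_cst.
under eq_fun do rewrite big_cons /=.
by apply: measurable_maxr => //; exact: measurable_rate.
Qed.

(** The inverse is continuous away from 0, and the point 0 is split off. *)
Lemma measurable_inve_EFin : measurable_fun [set: R] (fun r => (r%:E)^-1%E).
Proof.
rewrite -(setvU [set (0:R)]); apply/measurable_funU => //.
  exact: measurableC.
split; last exact: measurable_fun_set1.
apply: (@eq_measurable_fun _ _ _ _ _ (EFin \o (@GRing.inv R))).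
  by move=> r; rewrite inE/= => /eqP r0; rewrite inver (negPf r0).
apply/measurable_EFinP; apply: open_continuous_measurable_fun.
  by rewrite openC; apply: compact_closed (@Rhausdorff R) (@compact_set1 _ _).
by move=> r; rewrite inE => /eqP r0; apply: cvgV => //; exact: cvg_id.
Qed.

Lemma measurable_nneseries_inv (f : nat -> borel (env R L) -> R) k :
  (forall n w, 0 <= f n w) -> (forall n, measurable_fun setT (f n)) ->
  measurable [set w | (\sum_(k <= n <oo) ((f n w)%:E)^-1 = +oo)%E].
Proof.
move=> f0 mf.
have m : measurable_fun setT (fun w => \sum_(k <= n <oo) ((f n w)%:E)^-1)%E.
  rewrite (_ : (fun _ => _) = fun w => \sum_(n <oo) ((f (n + k)%N w)%:E)^-1)%E; last first.
    apply/funext => w; rewrite (@nneseries_addn _ (fun n => ((f n w)%:E)^-1)%E)//.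
    by move=> n; rewrite inve_ge0 lee_fin.
  apply: ge0_emeasurable_sum => [n w _ _|n _].
    by rewrite inve_ge0 lee_fin.
  exact: (measurableT_comp measurable_inve_EFin (mf _)).
rewrite -[X in measurable X]setTI.
by apply: (m _ [set +oo%E]) => //; exact: emeasurable_set1.
Qed.

Lemma measurable_series_divergence : measurable [set w : borel (env R L) |
  (\sum_(1 <= n <oo) ((rate w n%:Z)%:E)^-1 = +oo)%E /\
  (\sum_(0 <= n <oo) ((block_rate w (- n%:Z))%:E)^-1 = +oo)%E].
Proof.
apply: measurableI.
  apply: (@measurable_nneseries_inv (fun n w => rate w n%:Z)) => [n w|n].
    by rewrite (le_trans (lambda_ge0 w n))// lambda_le_rate.
  exact: measurable_rate.
apply: (@measurable_nneseries_inv (fun n w => block_rate w (- n%:Z))) => [n w|n].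
  exact: bigmax_ge_id.
exact: measurable_block_rate.
Qed.

Lemma ae_probability1 d (E : measurableType d) (P : probability E R)
    (A : set E) : measurable A -> P A = 1%E -> {ae P, forall x, A x}.
Proof.
move=> mA PA; exists (~` A); split => //; first exact: measurableC.
by rewrite probability_setC// PA subee.
Qed.

(** Positivity at site 0 passes to each site by identical distribution, and the sites are
    countable. *)
Lemma ae_rate_gt0 (P : probability (borel (env R L)) R) :
  identically_distributed P (@site R L) ->
  P [set w : env R L | 0 < rate w 0] = 1%E ->
  {ae P, forall w : env R L, forall i, 0 < rate w i}.
Proof.
move=> Pid P0.
pose B : set (borel 'rV[R]_L.+1) := [set v | 0 < vector_rate v].
have mB : measurable B.
  apply: sub_gen_smallest.
  by have /continuousP/(_ _ (@open_gt R 0)) := continuous_vector_rate.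
have ae1 i : {ae P, forall w : env R L, 0 < rate w i}.
  have mA : measurable [set w : borel (env R L) | 0 < rate w i].
    rewrite (_ : [set _ | _] = setT `&` (fun w : borel (env R L) => rate w i) @^-1` `]0, +oo[).
      by apply: measurable_rate => //; exact: measurable_itv.
    by apply/seteqP; split => w /=; rewrite in_itv/= andbT; [split|case].
  have PA : P [set w : borel (env R L) | 0 < rate w i] = 1%E by rewrite -P0; exact: (Pid i 0 B mB).
  exact: ae_probability1 mA PA.
(* Sites are enumerated by their codes; a number that decodes to no site carries the trivial
   event. *)
have := @ae_foralln _ _ _ P (fun n w => if @unpickle int n is Some i then 0 < rate w i else true).
move=> /(_ _)/filterS; apply.
  by move=> w wP i; have := wP (pickle i); rewrite pickleK.
by move=> n; case: unpickle => [i|]; [exact: ae1|exact: nearW].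
Qed.

End Measurability.

Theorem proposition1 (R : realType) (L : nat) (L_ge1 : (1 <= L)%N)
    (P : probability (borel (env R L)) R)
    (P_iid : iid P (@site R L))
    (C1 : P [set w : env R L | 0 < rate w 0] = 1%E)
    (C2 : P [set w : env R L |
        (\sum_(1 <= n <oo) ((rate w n%:Z)%:E)^-1 = +oo)%E /\
        (\sum_(0 <= n <oo) ((block_rate w (- n%:Z))%:E)^-1 = +oo)%E] = 1%E) :
  {ae P, forall w : env R L, exists p : R -> int -> int -> R,
    [/\ transition_matrix p, has_qmatrix p (qmatrix w) &
      forall p' : R -> int -> int -> R,
        transition_matrix p' -> has_qmatrix p' (qmatrix w) ->
        forall (t : R) (i j : int), 0 <= t -> p' t i j = p t i j]}.
Proof.
have rate_ae := ae_rate_gt0 P_iid.2 C1.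
have C2_ae := ae_probability1 (@measurable_series_divergence R L) C2.
(* On the intersection of the two almost sure events the result for a fixed environment applies. *)
apply: (filterS2 (ae_filter_ringOfSetsType P) _ rate_ae C2_ae).
move=> w rate_gt0 [right_oo left_oo].
exact: qmatrix_regular L_ge1 rate_gt0 right_oo left_oo.
Qed.
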